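(* Suppose (A1) and (V4') hold. Then there are $\alpha^0>0$ and positive constants $b,\delta$ such that for every $\alpha\in(0,\alpha^0]$ and every initial condition $\Theta_0\in\mathbb{R}^d$, $\Phi_0\in\Omega$, the solution of the QSA ODE $\frac{d}{dt}\Theta_t=\alpha f(\Theta_t,\xi_t)$ satisfies $$\|\Theta_t\|\le b\|\Theta_0\|\exp(-\alpha\delta t)\qquad\text{for } t\le T_1,\quad T_1=\min\{t\ge0:\|\Theta_t\|\le\delta^{-1}\}.$$ Consequently the family of QSA ODE models is $\alpha^0$-ultimately bounded: there is $B<\infty$ such that for every $\alpha\in(0,\alpha^0]$ and every initial condition there is a finite $t_0$ with $\|\Theta_t\|\le B$ for all $t\ge t_0$.
   Context: Setting. Fix $d,m,K\ge1$, frequencies $\omega_i>0$, phases $\phi_i$; clock process $\Phi^i_t=\exp(2\pi j[\omega_it+\phi_i])$, $\Omega$ the closure of its orbit (compact, flow invariant; any point may be the initial condition), $\pi$ the uniform probability on $\Omega$. The probing signal is $\xi_t=G(\Phi_t)$ with $G(z)=G_0((z+1/z)/2)$, $G_0\colon\mathbb{R}^K\to\mathbb{R}^m$ analytic with absolutely summable Taylor coefficients. $f\colon\mathbb{R}^d\times\mathbb{R}^m\to\mathbb{R}^d$ is continuous, $\bar f(\theta)=\int_\Omega f(\theta,G(z))\pi(dz)$, and the mean flow is $\frac{d}{dt}\vartheta_t=\bar f(\vartheta_t)$. (A1): there is $L_f$ with $\|\bar f(\theta')-\bar f(\theta)\|\le L_f\|\theta'-\theta\|$ and $\|f(\theta',\xi)-f(\theta,\xi)\|+\|f(\theta,\xi')-f(\theta,\xi)\|\le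 L_f[\|\theta'-\theta\|+\|\xi'-\xi\|]$. (V4'): there are a function $V\colon\mathbb{R}^d\to\mathbb{R}_+$ and constants $L_V<\infty$, $\delta_0>0$, $\delta_1>0$, $T>0$ such that $|V(\theta')-V(\theta)|\le L_V\|\theta'-\theta\|$ for all $\theta,\theta'$, $V(\theta)\ge\|\theta\|$ whenever $\|\theta\|\ge\delta_0^{-1}$, and every solution of the mean flow satisfies $V(\vartheta_{\tau+T})-V(\vartheta_\tau)\le-\delta_1\|\vartheta_\tau\|$ for all $\tau\ge0$ with $\|\vartheta_\tau\|>\delta_1^{-1}$. *)

(* Defs.v *)
From HB Require Import structures.
From mathcomp Require Import all_boot all_order all_algebra.
From mathcomp Require Import all_classical all_reals all_analysis.
Import Order.TTheory GRing.Theory Num.Theory.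
Import numFieldNormedType.Exports.

Set Implicit Arguments.
Unset Strict Implicit.
Unset Printing Implicit Defensive.

Local Open Scope ring_scope.
Local Open Scope classical_set_scope.

Section QSA.
Variable R : realType.

Definition enorm (n : nat) (v : 'rV[R]_n) : R :=
  Num.sqrt (\sum_(i < n) v ord0 i ^+ 2).

Definition mdeg (K n : nat) (a : {ffun 'I_K -> 'I_n.+1}) : bool :=
  \sum_(i < K) (a i : nat) == n.

Definition ps_block (K m : nat) (c : ('I_K -> nat) -> 'rV[R]_m)
    (x0 x : 'rV[R]_K) (n : nat) : 'rV[R]_m :=
  \sum_(a : {ffun 'I_K -> 'I_n.+1} | mdeg a)
     (\prod_(i < K) (x ord0 i - x0 ord0 i) ^+ (a i)) *: c (fun i => (a i : nat)).

Definition ps_absblock (K m : nat) (c : ('I_K -> nat) -> 'rV[R]_m)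
    (x0 x : 'rV[R]_K) (n : nat) : R :=
  \sum_(a : {ffun 'I_K -> 'I_n.+1} | mdeg a)
     (\prod_(i < K) `|x ord0 i - x0 ord0 i| ^+ (a i)) * enorm (c (fun i => (a i : nat))).

Definition ps_expansion (K m : nat) (G0 : 'rV[R]_K -> 'rV[R]_m) (x0 : 'rV[R]_K)
    (r : R) (c : ('I_K -> nat) -> 'rV[R]_m) : Prop :=
  forall x, enorm (x - x0) < r ->
    (exists l : R, series (ps_absblock c x0 x) @ \oo --> l) /\
    series (ps_block c x0 x) @ \oo --> G0 x.

Definition real_analytic (K m : nat) (G0 : 'rV[R]_K -> 'rV[R]_m) : Prop :=
  forall x0, exists r, 0 < r /\ exists c, ps_expansion G0 x0 r c.

Definition abs_summable_taylor (K m : nat) (G0 : 'rV[R]_K -> 'rV[R]_m) : Prop :=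
  exists r, 0 < r /\ exists c, ps_expansion G0 0 r c /\
    exists l : R, series (fun n => \sum_(a : {ffun 'I_K -> 'I_n.+1} | mdeg a)
                                     enorm (c (fun i => (a i : nat)))) @ \oo --> l.

(* A point z of (C^K) is stored as the K-tuple of pairs (Re z_i, Im z_i). *)
Definition torus (K : nat) := K.-tuple (R * R).

Definition clock (K : nat) (omega phi : 'I_K -> R) (t : R) : torus K :=
  [tuple (cos (2 * pi * (omega i * t + phi i)), sin (2 * pi * (omega i * t + phi i)))
  | i < K].

Definition Omega (K : nat) (omega phi : 'I_K -> R) : set (torus K) :=
  fun z => forall e : R, 0 < e -> exists t : R, forall i : 'I_K,
    `|(tnth z i).1 - (tnth (clock omega phi t) i).1| < e /\
    `|(tnth z i).2 - (tnth (clock omega phi t) i).2| < e.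

(* The flow: z_i |-> z_i * exp(2 pi j omega_i s). *)
Definition flow (K : nat) (omega : 'I_K -> R) (s : R) (z : torus K) : torus K :=
  [tuple let th := 2 * pi * omega i * s in
         ((tnth z i).1 * cos th - (tnth z i).2 * sin th,
          (tnth z i).1 * sin th + (tnth z i).2 * cos th) | i < K].

(* G(z) = G0((z + 1/z)/2); on the unit torus (z + 1/z)/2 = Re z. *)
Definition Gmap (K m : nat) (G0 : 'rV[R]_K -> 'rV[R]_m) (z : torus K) : 'rV[R]_m :=
  G0 (\row_(i < K) (tnth z i).1).

Definition uniform_on_Omega (K : nat) (omega phi : 'I_K -> R)
    (P : probability (torus K) R) : Prop :=
  P (Omega omega phi) = 1%:E /\
  forall (s : R) (A : set (torus K)), measurable A ->
    P (flow omega s @^-1` A) = P A.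

Definition fbar (d m K : nat) (P : probability (torus K) R)
    (G0 : 'rV[R]_K -> 'rV[R]_m) (f : 'rV[R]_d -> 'rV[R]_m -> 'rV[R]_d)
    (theta : 'rV[R]_d) : 'rV[R]_d :=
  \row_(k < d) Rintegral P setT (fun z => f theta (Gmap G0 z) ord0 k).

Definition ode_sol (d : nat) (F : R -> 'rV[R]_d -> 'rV[R]_d) (x : R -> 'rV[R]_d) : Prop :=
  (x t @[t --> 0^'+] --> x 0) /\
  forall t : R, 0 < t -> is_derive (t : R^o) (1 : R^o) x (F t (x t)).

Definition mean_flow_sol (d : nat) (fb : 'rV[R]_d -> 'rV[R]_d) (x : R -> 'rV[R]_d) :=
  ode_sol (fun _ y => fb y) x.

Definition qsa_sol (d m K : nat) (omega : 'I_K -> R) (G0 : 'rV[R]_K -> 'rV[R]_m)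
    (f : 'rV[R]_d -> 'rV[R]_m -> 'rV[R]_d) (alpha : R) (z : torus K)
    (x : R -> 'rV[R]_d) :=
  ode_sol (fun t y => alpha *: f y (Gmap G0 (flow omega t z))) x.

Definition A1 (d m : nat) (fb : 'rV[R]_d -> 'rV[R]_d)
    (f : 'rV[R]_d -> 'rV[R]_m -> 'rV[R]_d) : Prop :=
  exists Lf : R,
    (forall th th', enorm (fb th' - fb th) <= Lf * enorm (th' - th)) /\
    (forall th th' xi xi',
       enorm (f th' xi - f th xi) + enorm (f th xi' - f th xi)
       <= Lf * (enorm (th' - th) + enorm (xi' - xi))).

Definition V4' (d : nat) (fb : 'rV[R]_d -> 'rV[R]_d) : Prop :=
  exists (V : 'rV[R]_d -> R) (LV delta0 delta1 T : R),
    0 < delta0 /\ 0 < delta1 /\ 0 < T /\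
    (forall th, 0 <= V th) /\
    (forall th th', `|V th' - V th| <= LV * enorm (th' - th)) /\
    (forall th, delta0^-1 <= enorm th -> enorm th <= V th) /\
    (forall x, mean_flow_sol fb x ->
       forall tau, 0 <= tau -> delta1^-1 < enorm (x tau) ->
         V (x (tau + T)) - V (x tau) <= - (delta1 * enorm (x tau))).

End QSA.

(* Main.v *)
(* The forcing enters [f] with a Lipschitz constant that does not depend on the
   state, and the clock keeps [G] in a bounded set, so
   [|f theta xi_t - fbar theta|] is bounded uniformly in [theta] and [t]: no
   ergodic averaging is needed.  After the time change [t -> t / alpha] a QSA
   solution therefore solves the mean flow up to a bounded forcing, and by
   Gronwall it stays within a constant [D] of the mean flow over a time span [T],
   whatever its starting point.  Far from the origin the decrease
   [delta1 * |theta|] of [V] over [T] dominates [LV * D], so [V] contracts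
   geometrically along the QSA solution; near the origin [V] stays bounded over
   one span. *)

Require Import Defs.
From HB Require Import structures.
From mathcomp Require Import all_boot all_order all_algebra.
From mathcomp Require Import all_classical all_reals all_analysis.
From mathcomp Require Import measurable_realfun ring lra.
Import Order.TTheory GRing.Theory Num.Theory.
Import numFieldNormedType.Exports.
Import HBNNSimple.

Set Implicit Arguments.
Unset Strict Implicit.
Unset Printing Implicit Defensive.

Local Open Scope ring_scope.
Local Open Scope classical_set_scope.

(** * Integrals against a probability carried by a set *)

Local Open Scope ereal_scope.

(* [g] need not be measurable: the library's integral of a nonnegative function
   is the supremum of the integrals of the simple functions below it. *)
Lemma ge0_integral_le_on (d : measure_display) (T : measurableType d)
  (R : realType) (P : probability T R) (A : set T) (g : T -> \bar R) (c : R) :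
  measurable A -> P A = 1%:E -> (forall x, 0 <= g x) ->
  (0 <= c)%R -> (forall x, A x -> g x <= c%:E) -> \int[P]_x g x <= c%:E.
Proof.
move=> mA PA g0 c0 gc; rewrite ge0_integralTE//.
apply: ge_ereal_sup => _ [h /= hg <-]; rewrite -integralT_nnsfun.
rewrite [leRHS](_ : _ = \int[P]_x (cst c%:E x)); last first.
  rewrite integral_cst// [X in _ * X](_ : _ = 1) ?mule1//.
  exact: (@probability_setT _ _ _ P).
apply: ae_ge0_le_integral => //.
- by move=> x _; rewrite lee_fin; exact: fun_ge0.
- by apply/measurable_EFinP; apply: measurable_funTS.
- exists (~` A); split; [exact: measurableC| |].
    by rewrite -[LHS]/(P (~` A)) (probability_setC P mA) PA subee.
  move=> x /= nx Ax; apply: nx => _; exact: le_trans (hg x) (gc x Ax).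
Qed.

(** The simple function [c * \1_A] lies below [g] and has integral [c]. *)
Lemma ge0_integral_ge_on (d : measure_display) (T : measurableType d)
  (R : realType) (P : probability T R) (A : set T) (g : T -> \bar R) (c : R) :
  measurable A -> P A = 1%:E -> (forall x, 0 <= g x) ->
  (0 <= c)%R -> (forall x, A x -> c%:E <= g x) -> c%:E <= \int[P]_x g x.
Proof.
move=> mA PA g0 c0 gc; rewrite ge0_integralTE//; apply: ereal_sup_ubound.
exists (scale_nnsfun (indic_nnsfun R mA) c0) => /=.
  move=> x; rewrite -[leLHS]/((c * \1_A x)%:E) indicE.
  case: (boolP (x \in A)) => [|_]; last by rewrite mulr0.
  by rewrite inE mulr1; exact: gc.
have := sintegralrM P c (indic_nnsfun R mA).
by rewrite /= sintegral_indic [X in (_ * X)%E](_ : _ = 1%:E) ?mule1.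
Qed.

Local Close Scope ereal_scope.

(** As [g] may fail to be measurable, additivity of the integral is avoided: the positive and
    negative parts are bounded separately. Each contributes an error [M], whence the factor 2. *)
Lemma Rintegral_dist_le (d : measure_display) (T : measurableType d)
  (R : realType) (P : probability T R) (A : set T) (g : T -> R) (c M : R) :
  measurable A -> P A = 1%:E -> (forall x, A x -> `|g x - c| <= M) ->
  `|Rintegral P setT g - c| <= 2 * M.
Proof.
move=> mA PA gM.
have M0 : 0 <= M.
  have [A0|/set0P[x Ax]] := eqVneq A set0.
    by move: PA; rewrite A0 measure0 => -[] /eqP; rewrite eq_sym oner_eq0.
  by apply: le_trans (gM x Ax).
have part (h : T -> \bar R) (e : R) : (forall x, 0 <= h x)%E -> 0 <= e ->
    (forall x, A x -> (e - M)%:E <= h x <= (e + M)%:E)%E ->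
    exists2 r, (\int[P]_x h x)%E = r%:E & `|r - e| <= M.
  move=> h0 e0 hA.
  have le1 : (\int[P]_x h x <= (e + M)%:E)%E.
    apply: (@ge0_integral_le_on _ _ _ P A) => //; first exact: addr_ge0.
    by move=> x /hA/andP[].
  (* The lower bound is cut off at 0, since [ge0_integral_ge_on] takes a nonnegative constant. *)
  have ge1 : ((Num.max 0 (e - M))%:E <= \int[P]_x h x)%E.
    apply: (@ge0_integral_ge_on _ _ _ P A) => //; first by rewrite le_max lexx.
    by move=> x /hA/andP[hx _]; rewrite EFin_max ge_max h0.
  case: (\int[P]_x h x)%E le1 ge1 => [r||]//; rewrite !lee_fin.
  rewrite ge_max => r1 /andP[_ r2]; exists r => //.
  by rewrite ler_distl r1 r2.
have [|||p ip pe] := part (fun x => maxe (g x)%:E 0) (Num.max c 0).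
- by move=> x; rewrite le_max lexx orbT.
- by rewrite le_max lexx orbT.
- move=> x /gM; rewrite -EFin_max !lee_fin ler_distl => /andP[g1 g2].
  by case: (leP (g x) 0); case: (leP c 0) => c0 gx0; lra.
have [|||q iq qe] := part (fun x => maxe (- (g x)%:E)%E 0) (Num.max (- c) 0).
- by move=> x; rewrite le_max lexx orbT.
- by rewrite le_max lexx orbT.
- move=> x /gM; rewrite -EFinN -EFin_max !lee_fin ler_distl => /andP[g1 g2].
  by case: (leP (- g x) 0); case: (leP (- c) 0) => c0 gx0; lra.
rewrite /Rintegral integralE.
have -> : (\int[P]_x ((fun x => (g x)%:E)^\+ x) = p%:E)%E.
  by rewrite -ip; apply: eq_integral => x _; rewrite funeposE.
have -> : (\int[P]_x ((fun x => (g x)%:E)^\- x) = q%:E)%E.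
  by rewrite -iq; apply: eq_integral => x _; rewrite funenegE.
rewrite -EFinB /= ler_distl.
move: pe qe; rewrite !ler_distl => /andP[] + + /andP[].
by case: (leP c 0); case: (leP (- c) 0) => c0 c0' p1 p2 q1 q2; lra.
Qed.

(** * Measurability of the closure of the clock orbit *)

Lemma nbhs_ratr (R : realType) (t : R) (B : set R) : nbhs t B ->
  exists q : rat, B (ratr q).
Proof.
move=> [e /= e0 tB].
have [x [/= tx [q _ qx]]] : (ball t e `&` range ratr) !=set0.
  by apply: dense_rat; [exists t; exact: ballxx|exact: ball_open].
by exists q; rewrite qx; exact: tB.
Qed.

(** By continuity of the clock, rational times suffice to approximate a point of the closure, which
    makes it a countable intersection of countable unions of boxes. *)
Lemma measurable_Omega (R : realType) (K : nat) (omega phi : 'I_K -> R) :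
  measurable (Omega omega phi).
Proof.
have -> : Omega omega phi = \bigcap_(n in [set: nat]) \bigcup_(q in [set: rat])
    \bigcap_(i in [set: 'I_K])
      ([set z : torus R K | `|(tnth z i).1 -
          (tnth (clock omega phi (ratr q)) i).1| < n.+1%:R^-1] `&`
       [set z | `|(tnth z i).2 -
          (tnth (clock omega phi (ratr q)) i).2| < n.+1%:R^-1]).
  apply/seteqP; split=> [z Oz n _|z Oz e e0].
    have n0 : 0 < n.+1%:R^-1 :> R by rewrite invr_gt0.
    have [t tz] := Oz _ n0.
    pose near_z i s :=
        `|(tnth z i).1 - (tnth (clock omega phi s) i).1| < n.+1%:R^-1 /\
        `|(tnth z i).2 - (tnth (clock omega phi s) i).2| < n.+1%:R^-1.
    have : \forall s \near t, forall i, near_z i s.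
      apply: (@filter_forall R _ near_z (nbhs t)) => i.
      rewrite /near_z; have [zi1 zi2] := tz i.
      have cth : (2 * pi * (omega i * s + phi i)) @[s --> t] -->
                 2 * pi * (omega i * t + phi i).
        apply: cvgM; first exact: cvg_cst.
        by apply: cvgD; [apply: cvgM; [exact: cvg_cst|exact: cvg_id]|exact: cvg_cst].
      move: zi1 zi2; rewrite !tnth_mktuple/= => zi1 zi2.
      have c1 : `|(tnth z i).1 - cos (2 * pi * (omega i * s + phi i))| @[s --> t]
          --> `|(tnth z i).1 - cos (2 * pi * (omega i * t + phi i))|.
        apply: cvg_norm; apply: cvgB; first exact: cvg_cst.
        exact: cvg_comp cth (@continuous_cos _ _).
      have c2 : `|(tnth z i).2 - sin (2 * pi * (omega i * s + phi i))| @[s --> t]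
          --> `|(tnth z i).2 - sin (2 * pi * (omega i * t + phi i))|.
        apply: cvg_norm; apply: cvgB; first exact: cvg_cst.
        exact: cvg_comp cth (@continuous_sin _ _).
      near=> s; rewrite !tnth_mktuple/=; split.
        by near: s; exact: (cvgr_lt _ c1).
      by near: s; exact: (cvgr_lt _ c2).
    move=> /nbhs_ratr[q qz]; exists q => // i _; exact: qz.
  have [n ne] : exists n : nat, n.+1%:R^-1 < e.
    exists (Num.bound e^-1); rewrite invf_plt ?posrE//.
    apply: (@lt_trans _ _ (Num.bound e^-1)%:R); last by rewrite ltr_nat.
    by apply: archi_boundP; rewrite invr_ge0 ltW.
  have [q _ qz] := Oz n I.
  exists (ratr q) => i; have [? ?] := qz i I.
  by split; exact: lt_trans ne.
apply: bigcapT_measurable => n; apply: bigcupT_measurable_rat => q.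
apply: fin_bigcap_measurable => // i _.
have mlt (h : torus R K -> R) (c e : R) : measurable_fun setT h ->
    measurable [set z | `|h z - c| < e].
  move=> mh; rewrite -[X in measurable X]setTI.
  apply: (@measurable_lte _ _ _ setT measurableT (fun z => `|h z - c|%:E)
    (fun=> e%:E)) => //.
  apply/measurable_EFinP => //.
  apply: measurableT_comp; first exact: normr_measurable.
  by apply: measurable_funB.
apply: measurableI; apply: mlt.
- by apply: (measurableT_comp measurable_fst); exact: measurable_tnth.
- by apply: (measurableT_comp measurable_snd); exact: measurable_tnth.
Unshelve. all: by end_near. Qed.

(** * Boundedness of analytic maps on cubes *)

Lemma coord_le_normr (R : realType) (n : nat) (v : 'rV[R]_n) (k : 'I_n) :
  `|v ord0 k| <= `|v|.
Proof.
rewrite [leRHS]/Num.Def.normr/= mx_normrE.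
exact: (le_bigmax 0 (fun ij : 'I_1 * 'I_n => `|v ij.1 ij.2|) (ord0, k)).
Qed.

Lemma normr_rV_le (R : realType) (n : nat) (v : 'rV[R]_n) (e : R) : 0 <= e ->
  (forall k, `|v ord0 k| <= e) -> `|v| <= e.
Proof.
move=> e0 ve; rewrite [leLHS]/Num.Def.normr/= mx_normrE.
by apply: bigmax_le => //= -[i j] _ /=; rewrite ord1.
Qed.

Lemma enorm_ge0 (R : realType) (n : nat) (v : 'rV[R]_n) : 0 <= enorm v.
Proof. exact: sqrtr_ge0. Qed.

Lemma sqr_enorm (R : realType) (n : nat) (v : 'rV[R]_n) :
  enorm v ^+ 2 = \sum_(i < n) v ord0 i ^+ 2.
Proof. by rewrite sqr_sqrtr// sumr_ge0// => i _; exact: sqr_ge0. Qed.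

Lemma normr_le_enorm (R : realType) (n : nat) (v : 'rV[R]_n) : `|v| <= enorm v.
Proof.
apply: normr_rV_le => [|k]; first exact: enorm_ge0.
rewrite -ler_sqr ?nnegrE ?enorm_ge0// sqr_enorm real_normK ?num_real//.
by rewrite (bigD1 k)//= lerDl sumr_ge0// => i _; exact: sqr_ge0.
Qed.

Lemma enorm_le_normr (R : realType) (n : nat) (v : 'rV[R]_n) :
  enorm v <= n%:R * `|v|.
Proof.
rewrite -ler_sqr ?nnegrE ?enorm_ge0 ?mulr_ge0// sqr_enorm.
apply: (@le_trans _ _ (\sum_(i < n) `|v| ^+ 2)).
  apply: ler_sum => i _; rewrite -real_normK ?num_real//.
  by rewrite ler_sqr ?nnegrE//; exact: coord_le_normr.
rewrite sumr_const card_ord exprMn -[leLHS]mulr_natl ler_wpM2r ?sqr_ge0//.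
by rewrite -natrX ler_nat; case: n v => // n v; rewrite leq_pmulr.
Qed.

(** On the cube of radius [rho] every term of the series is dominated by its absolute value at the
    corner [xs], where the series of absolute values converges; that sum bounds [G0] on the whole
    cube. *)
Lemma ps_expansion_bounded (R : realType) (K m : nat)
  (G0 : 'rV[R]_K -> 'rV[R]_m) (x0 : 'rV[R]_K) (r : R)
  (c : ('I_K -> nat) -> 'rV[R]_m) : 0 < r -> ps_expansion G0 x0 r c ->
  exists rho M : R, 0 < rho /\ forall x, `|x - x0| <= rho -> `|G0 x| <= M.
Proof.
(* [K.+1] makes the Euclidean norm on this cube, at most [K%:R * rho], strictly smaller than [r]. *)
move=> r0 G0c; pose rho : R := r / K.+1%:R.
have rho0 : 0 < rho by rewrite divr_gt0.
have inr (x : 'rV[R]_K) : `|x - x0| <= rho -> enorm (x - x0) < r.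
  move=> xrho; apply: le_lt_trans (enorm_le_normr _) _.
  apply: (@le_lt_trans _ _ (K%:R * rho)); first exact: ler_wpM2l.
  by rewrite mulrCA gtr_pMr// ltr_pdivrMr// mul1r ltr_nat.
pose xs := x0 + const_mx rho.
have xsE i : xs ord0 i - x0 ord0 i = rho by rewrite !mxE addrC addKr.
have xs_rho : `|xs - x0| <= rho.
  apply: normr_rV_le => [|k]; first exact: ltW.
  by have := xsE k; rewrite !mxE => ->; rewrite gtr0_norm.
have [[l sl] _] := G0c _ (inr _ xs_rho).
exists rho, l; split => // x xrho.
have [_ sx] := G0c _ (inr _ xrho).
have le_l n : series (ps_absblock c x0 xs) n <= l.
  have sE : limn (series (ps_absblock c x0 xs)) = l by exact/cvg_lim.
  rewrite -sE; apply: nondecreasing_cvgn_le; last by apply/cvg_ex; exists l.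
  apply/nondecreasing_seqP => {}n; rewrite seriesSr lerDl.
  apply: sumr_ge0 => a _; apply: mulr_ge0; last exact: enorm_ge0.
  by apply: prodr_ge0 => i _; exact: exprn_ge0.
have sn n : `|series (ps_block c x0 x) n| <= l.
  apply: le_trans (le_l n); rewrite /series/=.
  apply: le_trans (ler_norm_sum _ _ _) _; apply: ler_sum => j _.
  apply: le_trans (ler_norm_sum _ _ _) _; apply: ler_sum => a _.
  rewrite normrZ normr_prod; apply: ler_pM => //;
    [exact: prodr_ge0| |exact: normr_le_enorm].
  apply: ler_prod => i _; rewrite normrX exprn_ge0//= lerXn2r ?nnegrE//.
  rewrite xsE (gtr0_norm rho0); apply: le_trans xrho.
  by have := coord_le_normr (x - x0) i; rewrite !mxE.
apply: (ler_cvg_to (cvg_norm sx) (cvg_cst l)).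
by apply: nearW => n; exact: sn.
Qed.

Lemma real_analytic_bounded (R : realType) (K m : nat)
  (G0 : 'rV[R]_K -> 'rV[R]_m) (a : R) : real_analytic G0 ->
  exists M : R, forall x : 'rV[R]_K, (forall i, `|x ord0 i| <= a) -> `|G0 x| <= M.
Proof.
move=> aG0.
have : compact [set x : 'rV[R]_K | forall i, `[- a, a]%classic (x ord0 i)].
  exact: (@rV_compact _ _ (fun=> `[- a, a]%classic) (fun=> @segment_compact _ _ _)).
(* Near-covering compactness with the bound [M] running along [+oo] merges the local bounds into a
   single one. *)
move/compact_near_coveringP => /(_ R +oo (fun M x => `|G0 x| <= M) _).
case=> [x0 _|M0 [_ HM]].
  have [r [r0 [c /(ps_expansion_bounded r0)]]] := aG0 x0.
  move=> [rho [M [rho0 bM]]].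
  exists ([set x | `|x - x0| <= rho], [set M' | M <= M']) => /=.
    split; last exact: nbhs_pinfty_ge (num_real _).
    apply/nbhs_ballP; exists rho => //= x; rewrite -ball_normE/= => xr.
    by rewrite distrC ltW.
  by move=> [x M'] /= [/bM]; exact: le_trans.
exists (M0 + 1) => x xa; apply: HM => [|i /=]; first by rewrite ltrDl.
by rewrite in_itv/= -ler_norml; exact: xa.
Qed.

(** * Differential inequalities *)

(** The mean value theorem on [[0, t]]. Right continuity is all that [ode_sol] provides at time
    0. *)
Lemma le_at0_of_derive_le0 (R : realType) (h dh : R -> R) :
  h t @[t --> (0 : R)^'+] --> h 0 ->
  (forall t : R, 0 < t -> is_derive t 1 h (dh t)) ->
  (forall t, 0 < t -> dh t <= 0) -> forall t, 0 <= t -> h t <= h 0.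
Proof.
move=> h0 hd dh0 t; rewrite le_eqVlt => /predU1P[<-//|t0].
have hc s : 0 < s -> {for s, continuous h}.
  move=> s0; apply: differentiable_continuous; apply/derivable1_diffP.
  by have [] := hd s s0.
have ch : {within `[0, t], continuous h}.
  apply/continuous_within_itvP => //; split => //.
    by move=> s; rewrite in_itv/= => /andP[s0 _]; exact: hc.
  by apply: cvg_at_left_filter; exact: hc.
have [|c ct hE] := @MVT _ h dh 0 t t0 _ ch.
  by move=> s; rewrite in_itv/= => /andP[s0 _]; exact: hd.
move: ct; rewrite in_itv/= => /andP[c0 _].
by rewrite -subr_le0 hE subr0 mulr_le0_ge0 ?(ltW t0)// dh0.
Qed.

Lemma is_derive_expRM (R : realType) (a t : R) :
  is_derive t 1 (fun s => expR (a * s)) (a * expR (a * t)).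
Proof.
rewrite mulrC; apply: (@is_derive1_comp _ expR (fun s => a * s)).
by have := is_deriveZ a (is_derive_id t (1 : R)); rewrite /GRing.scale/= mulr1.
Qed.

Lemma cvg_expRM (R : realType) (a t : R) : expR (a * s) @[s --> t] --> expR (a * t).
Proof.
have : {for t, continuous (fun s : R => expR (a * s))} by
  apply: differentiable_continuous; apply/derivable1_diffP;
  have [] := is_derive_expRM a t.
exact.
Qed.

(** The function [(u t + b / a) * expR (- a * t)] is nonincreasing. *)
Lemma gronwall (R : realType) (u du : R -> R) (a b : R) : 0 < a ->
  u t @[t --> (0 : R)^'+] --> u 0 ->
  (forall t : R, 0 < t -> is_derive t 1 u (du t)) ->
  (forall t, 0 < t -> du t <= a * u t + b) ->
  forall t, 0 <= t -> u t + b / a <= (u 0 + b / a) * expR (a * t).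
Proof.
move=> a0 u0 ud dule t t0.
pose h s := (u s + b / a) * expR (- a * s).
suff ht : h t <= h 0.
  move: ht; rewrite /h mulr0 expR0 mulr1 mulNr expRN.
  by rewrite ler_pdivrMr ?expR_gt0.
apply: (@le_at0_of_derive_le0 _ h (fun s =>
  (u s + b / a) *: (- a * expR (- a * s)) + expR (- a * s) *: (du s + 0))) => //.
- apply: cvgM; first by apply: cvgD => //; exact: cvg_cst.
  by apply: cvg_at_right_filter; exact: cvg_expRM.
- move=> s s0; apply: is_deriveM; last exact: is_derive_expRM.
  by apply: is_deriveD; exact: ud.
move=> s s0; rewrite /GRing.scale/= addr0.
have := dule s s0; have := expR_gt0 (- a * s).
set E := expR _ => E0 dus.
have -> : (u s + b / a) * (- a * E) + E * du s = E * (du s - (a * u s + b)).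
  by field; rewrite gt_eqF.
by rewrite pmulr_rle0// subr_le0.
Qed.

(** For both signs [e], the function [e * h t - c / a * expR (a * t)] is nonincreasing and starts at
    or below 0. The division by [a] is what makes the Picard map contract in a weighted norm. *)
Lemma le_expR_of_derive_le (R : realType) (h dh : R -> R) (a c : R) : 0 < a ->
  h 0 = 0 -> h t @[t --> (0 : R)^'+] --> h 0 ->
  (forall t : R, 0 < t -> is_derive t 1 h (dh t)) ->
  (forall t, 0 < t -> `|dh t| <= c * expR (a * t)) ->
  forall t, 0 <= t -> `|h t| <= c / a * expR (a * t).
Proof.
move=> a0 h00 hc hd dhle t t0.
have c0 : 0 <= c.
  by have := le_trans (normr_ge0 _) (dhle 1 ltr01); rewrite pmulr_lge0 ?expR_gt0.
have key (e : R) : `|e| = 1 -> e * h t <= c / a * expR (a * t).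
  move=> e1; pose g s := e * h s - c / a * expR (a * s).
  have : g t <= g 0.
    apply: (@le_at0_of_derive_le0 _ g
      (fun s => e *: dh s - (c / a) *: (a * expR (a * s)))) => //.
    - apply: cvgB; first by apply: cvgM => //; exact: cvg_cst.
      apply: cvgM; first exact: cvg_cst.
      by apply: cvg_at_right_filter; exact: cvg_expRM.
    - move=> s s0; apply: is_deriveB; apply: is_deriveZ; first exact: hd.
      exact: is_derive_expRM.
    move=> s s0; rewrite /GRing.scale/= mulrA divfK ?gt_eqF// subr_le0.
    by apply: le_trans (ler_norm _) _; rewrite normrM e1 mul1r dhle.
  rewrite /g h00 mulr0 mulr0 expR0 mulr1 sub0r lerBlDr => gt.
  by apply: le_trans gt _; rewrite gerDr oppr_le0 divr_ge0// ltW.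
have := key 1 (normr1 _); have := key (- 1); rewrite normrN1 => /(_ erefl).
by rewrite ler_norml mul1r mulN1r lerNl => -> ->.
Qed.

(** * Global existence for Lipschitz vector fields *)

Lemma is_derive_coord (R : realType) (n : nat) (x : R -> 'rV[R]_n) (t : R)
  (v : 'rV[R]_n) : is_derive (t : R^o) (1 : R^o) x v <->
  forall k, is_derive t 1 (fun s => x s ord0 k) (v ord0 k).
Proof.
split=> [[dx <-] k|dx].
  have dxk := (derivable_mxP _ _ _).1 dx.
  by rewrite derive_mx// mxE; exact: DeriveDef (dxk ord0 k) _.
have dxk : derivable (x : R^o -> _) (t : R^o) (1 : R^o).
  by apply/derivable_mxP => i k; rewrite ord1; have [] := dx k.
apply: DeriveDef => //; rewrite derive_mx//; apply/rowP => k.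
by rewrite mxE; have [] := dx k.
Qed.

(* Based at -1 so that it is differentiable on both sides at 0. *)
Definition antiderivative (R : realType) (g : R -> R) (t : R) : R :=
  Rintegral lebesgue_measure `[-1, t] g - Rintegral lebesgue_measure `[-1, 0] g.

Lemma antiderivative0 (R : realType) (g : R -> R) : antiderivative g 0 = 0.
Proof. exact: subrr. Qed.

Lemma is_derive_antiderivative (R : realType) (g : R -> R) (t : R) :
  continuous g -> 0 <= t -> is_derive t 1 (antiderivative g) (g t).
Proof.
move=> cg t0.
(* The endpoint [t + 1] puts [t] in the interior of the interval of integration. *)
have tt : t < t + 1 by rewrite ltrDl.
have [|||dF FE] := continuous_FTC1_closed (f := g) (a := -1) tt.
- apply: continuous_compact_integrable; first exact: segment_compact.
  by apply: continuous_subspaceT => x; exact: cg.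
- by apply: lt_le_trans t0; rewrite ltrN10.
- exact: cg.
rewrite -[g t]subr0; apply: is_deriveB.
by apply: DeriveDef => //; rewrite -FE derive1E.
Qed.

(** The intervals of centre [a n] and radius [2 * c / 2 ^+ n], the sum of the bounds on the
    remaining increments, are nested; the supremum of their left ends lies in all of them. *)
Lemma geometric_increments_limit (R : realType) (a : nat -> R) (c : R) :
  (forall n, `|a n.+1 - a n| <= c / 2 ^+ n) ->
  exists l, forall n, `|l - a n| <= 2 * c / 2 ^+ n.
Proof.
move=> ac.
have step n : a n - 2 * c / 2 ^+ n <= a n.+1 - 2 * c / 2 ^+ n.+1 /\
              a n.+1 + 2 * c / 2 ^+ n.+1 <= a n + 2 * c / 2 ^+ n.
  have -> : 2 * c / 2 ^+ n.+1 = c / 2 ^+ n.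
    by rewrite exprS; field; rewrite expf_neq0.
  by have := ac n; rewrite -mulrA ler_norml; lra.
have up m n : (m <= n)%N -> a m - 2 * c / 2 ^+ m <= a n - 2 * c / 2 ^+ n.
  move=> /subnK <-; elim: (n - m)%N => [|k ih]; first by rewrite add0n.
  by apply: le_trans ih _; rewrite addSn; have [] := step (k + m)%N.
have dn m n : (m <= n)%N -> a n + 2 * c / 2 ^+ n <= a m + 2 * c / 2 ^+ m.
  move=> /subnK <-; elim: (n - m)%N => [|k ih]; first by rewrite add0n.
  by apply: le_trans ih; rewrite addSn; have [] := step (k + m)%N.
have c0 n : 0 <= 2 * c / 2 ^+ n.
  by rewrite -mulrA mulr_ge0// (le_trans _ (ac n)).
have cross m n : a m - 2 * c / 2 ^+ m <= a n + 2 * c / 2 ^+ n.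
  have := c0 (maxn m n); have := up _ _ (leq_maxl m n).
  by have := dn _ _ (leq_maxr m n); lra.
pose S := range (fun n => a n - 2 * c / 2 ^+ n).
exists (sup S) => n.
have Sub m : ubound S (a m + 2 * c / 2 ^+ m) by move=> _ [k _ <-].
have S0 : S !=set0 by exists (a 0 - 2 * c / 2 ^+ 0); exists 0%N.
rewrite ler_distl; apply/andP; split; last exact: ge_sup.
by apply: ub_le_sup; [exists (a 0 + 2 * c / 2 ^+ 0)|exists n].
Qed.

Section picard.
Context (R : realType) (d : nat) (F : 'rV[R]_d -> 'rV[R]_d) (L : R).
Hypotheses (L0 : 0 < L).
Hypothesis (FL : forall u v, `|F u - F v| <= L * `|u - v|).

(** Freezing the path at its time-0 value for negative times turns continuity on the half-line into
    continuity on the whole line, as [antiderivative], based at -1, requires. *)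
Let clip (z : R -> 'rV[R]_d) (t : R) : 'rV[R]_d := z (Num.max t 0).

Let pic (theta : 'rV[R]_d) (z : R -> 'rV[R]_d) (t : R) : 'rV[R]_d :=
  theta + \row_k antiderivative (fun s => F (clip z s) ord0 k) t.

Let clipE z t : 0 <= t -> clip z t = z t.
Proof. by move=> t0; rewrite /clip max_l. Qed.

Let F_cont z k : continuous (clip z) -> continuous (fun s => F (clip z s) ord0 k).
Proof.
move=> cz t; apply/cvgrPdist_le => e e0.
have := cz t; move/cvgrPdist_le => /(_ (e / L)); rewrite divr_gt0// => /(_ isT).
apply: filterS => s zs.
have := coord_le_normr (F (clip z t) - F (clip z s)) k; rewrite !mxE => /le_trans.
apply; apply: le_trans (FL _ _) _.
by rewrite -ler_pdivlMl// mulrC.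
Qed.

Let pic0 theta z : pic theta z 0 = theta.
Proof. by apply/rowP => k; rewrite !mxE antiderivative0 addr0. Qed.

Let pic_derive theta z (t : R) k : continuous (clip z) -> 0 <= t ->
  is_derive t 1 (fun s => pic theta z s ord0 k) (F (z t) ord0 k).
Proof.
move=> cz t0.
have -> : (fun s => pic theta z s ord0 k) =
    (cst (theta ord0 k) + antiderivative (fun s => F (clip z s) ord0 k)).
  by apply/funext => s; rewrite !mxE.
rewrite -[F (z t) ord0 k]add0r; apply: is_deriveD.
by rewrite -(clipE z t0); apply: is_derive_antiderivative => //; exact: F_cont.
Qed.

Let clip_cont z : (forall t : R, 0 <= t -> {for t, continuous z}) -> continuous (clip z).
Proof.
move=> cz t; have t0 : 0 <= Num.max t 0 by rewrite le_max lexx orbT.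
have maxc : {for t, continuous ((fun s : R => s) \max (fun=> 0))}.
  by apply: continuous_max; [exact: cvg_id|exact: cvg_cst].
exact: (cvg_comp _ _ maxc (cz _ t0)).
Qed.

Let pic_cont theta z : continuous (clip z) ->
  forall t : R, 0 <= t -> {for t, continuous (pic theta z)}.
Proof.
move=> cz t t0.
have : is_derive (t : R^o) (1 : R^o) (pic theta z) (F (z t)).
  by apply/is_derive_coord => k; exact: pic_derive.
by case=> dp _; apply: differentiable_continuous; apply/derivable1_diffP.
Qed.

(* In the norm weighted by [expR (2 * L * t)] the Picard map is a contraction of
   ratio 1/2 on the whole half-line, so no gluing of local solutions is needed. *)
Let pic_lip theta (y z : R -> 'rV[R]_d) (c : R) :
  continuous (clip y) -> continuous (clip z) ->
  (forall t : R, 0 <= t -> `|y t - z t| <= c * expR (2 * L * t)) ->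
  forall t : R, 0 <= t ->
    `|pic theta y t - pic theta z t| <= c / 2 * expR (2 * L * t).
Proof.
move=> cy cz yz t t0; have L20 : 0 < 2 * L by rewrite mulr_gt0.
have c0 : 0 <= c.
  by have := le_trans (normr_ge0 _) (yz 0 (lexx _)); rewrite pmulr_lge0 ?expR_gt0.
apply: normr_rV_le => [|k].
  by rewrite mulr_ge0 ?expR_ge0// divr_ge0.
(* The weight grows at rate [2 * L], twice the Lipschitz constant: this is the source of the ratio
   1/2. *)
have -> : c / 2 = L * c / (2 * L) by field; rewrite gt_eqF.
pose h s := pic theta y s ord0 k - pic theta z s ord0 k.
have hd (s : R) : 0 <= s -> is_derive s 1 h (F (y s) ord0 k - F (z s) ord0 k).
  by move=> s0; apply: is_deriveB; exact: pic_derive.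
rewrite (_ : (pic theta y t - pic theta z t) ord0 k = h t); last first.
  by rewrite mxE [X in _ + X]mxE.
apply: (@le_expR_of_derive_le _ h
  (fun s => F (y s) ord0 k - F (z s) ord0 k)) => //.
- by rewrite /h !pic0 subrr.
- apply: cvg_at_right_filter.
  have [+ _] := hd 0 (lexx 0) => /derivable1_diffP.
  exact: differentiable_continuous.
- by move=> s s0; exact: hd (ltW s0).
move=> s s0; have := coord_le_normr (F (y s) - F (z s)) k; rewrite !mxE => /le_trans.
apply; apply: le_trans (FL _ _) _.
by rewrite -mulrA ler_pM2l// yz// ltW.
Qed.

(** The iterates started from the constant path converge geometrically in the weighted norm. The
    limit [X] is built pointwise, then shown to be continuous and fixed by the Picard map. *)
Lemma picard (theta : 'rV[R]_d) : exists x : R -> 'rV[R]_d,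
  x 0 = theta /\ ode_sol (fun=> F) x.
Proof.
pose E t := expR (2 * L * t).
have E0 t : 0 < E t by exact: expR_gt0.
have L20 : 0 < 2 * L by rewrite mulr_gt0.
pose xn n := iter n (pic theta) (fun=> theta).
have xnc n : continuous (clip (xn n)).
  elim: n => [|n ih]; apply: clip_cont => t t0; first exact: cvg_cst.
  exact: pic_cont.
(* Bound on the first increment in the weighted norm: that increment has constant derivative
   [F theta]. *)
pose C := `|F theta| / (2 * L).
have C0 : 0 <= C by rewrite divr_ge0// ltW.
have Cn n : 0 <= 2 * C / 2 ^+ n by apply: divr_ge0; [exact: mulr_ge0|exact: exprn_ge0].
have inc n (t : R) : 0 <= t -> `|xn n.+1 t - xn n t| <= C / 2 ^+ n * E t.
  elim: n t => [|n ih] t t0; last first.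
    rewrite exprSr invfM mulrA.
    exact: (pic_lip theta (xnc n.+1) (xnc n) ih t0).
  rewrite expr0 divr1; apply: normr_rV_le => [|k].
    by apply: mulr_ge0 => //; exact: ltW.
  pose h s := xn 1%N s ord0 k - theta ord0 k.
  have hd (s : R) : 0 <= s -> is_derive s 1 h (F theta ord0 k - 0).
    by move=> s0; apply: is_deriveB; exact: (pic_derive theta k (xnc 0%N)).
  rewrite (_ : (xn 1%N t - xn 0%N t) ord0 k = h t); last first.
  by rewrite mxE [X in _ + X]mxE.
  apply: (@le_expR_of_derive_le _ h (fun=> F theta ord0 k - 0)) => //.
  - by rewrite /h /xn/= pic0 subrr.
  - apply: cvg_at_right_filter.
    have [+ _] := hd 0 (lexx 0) => /derivable1_diffP.
    exact: differentiable_continuous.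
  - by move=> s s0; exact: hd (ltW s0).
  move=> s s0; rewrite subr0; apply: (le_trans (coord_le_normr _ _)).
  apply: ler_peMr => //; rewrite -[leLHS]expR0 ler_expR.
  by apply: mulr_ge0; exact: ltW.
have lim_ex t k : exists l, 0 <= t ->
    forall n, `|l - xn n t ord0 k| <= 2 * (C * E t) / 2 ^+ n.
  (* At negative times the limit is an arbitrary value. *)
  have [t0|] := leP 0 t; last by exists 0.
  have [|l lP] := @geometric_increments_limit _ (fun n => xn n t ord0 k) (C * E t).
    move=> n; rewrite mulrAC; apply: le_trans (inc n t t0).
    by have := coord_le_normr (xn n.+1 t - xn n t) k; rewrite !mxE.
  by exists l => _.
pose X t := \row_k projT1 (cid (lim_ex t k)).
have XP n (t : R) : 0 <= t -> `|X t - xn n t| <= 2 * C / 2 ^+ n * E t.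
  move=> t0; apply: normr_rV_le => [|k].
    by apply: mulr_ge0 => //; exact: ltW.
  rewrite !mxE; case: cid => l /= /(_ t0 n) /le_trans; apply.
  by rewrite mulrA mulrAC.
have small (t e : R) : 0 < e -> exists n, 2 * C / 2 ^+ n * E t < e.
  move=> e0; pose A := 2 * C * E t / e.
  exists (Num.bound A); rewrite mulrAC ltr_pdivrMr ?exprn_gt0//.
  rewrite [ltRHS]mulrC -ltr_pdivrMr//.
  have /archi_boundP : 0 <= A.
    apply: divr_ge0 (ltW e0); apply: mulr_ge0 (ltW (E0 _)); exact: mulr_ge0.
  move=> /lt_trans; apply.
  by rewrite -natrX ltr_nat ltn_expl.
have Xc : continuous (clip X).
  move=> t; apply/cvgrPdist_lt => e e0.
  have e3 : 0 < e / 3 by rewrite divr_gt0.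
  (* The weight increases with time, so closeness at [Num.max t 0 + 1] is uniform over the times
     before [t + 1]. *)
  have [n ne] := small (Num.max t 0 + 1) _ e3.
  have close (s : R) : s < t + 1 -> `|clip X s - clip (xn n) s| < e / 3.
    move=> st; apply: le_lt_trans ne; rewrite /clip.
    have s0 : 0 <= Num.max s 0 by rewrite le_max lexx orbT.
    apply: le_trans (XP n _ s0) _; apply: ler_wpM2l => //.
    rewrite ler_expR ler_pM2l// ge_max.
    have t1 : t <= Num.max t 0 by rewrite le_max lexx.
    have t2 : 0 <= Num.max t 0 by rewrite le_max lexx orbT.
    by apply/andP; split; lra.
  have /cvgrPdist_lt/(_ _ e3) xe := xnc n t.
  near=> s.
  have st : s < t + 1 by near: s; apply: lt_nbhsl; rewrite ltrDl.
  have c1 : `|clip X t - clip (xn n) t| < e / 3 by apply: close; rewrite ltrDl.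
  have c2 : `|clip (xn n) t - clip (xn n) s| < e / 3 by near: s; exact: xe.
  have c3 := close s st; rewrite distrC in c3.
  have -> : clip X t - clip X s = (clip X t - clip (xn n) t) +
      (clip (xn n) t - clip (xn n) s) + (clip (xn n) s - clip X s).
    by rewrite !subrKA.
  apply: le_lt_trans (ler_normD _ _) _.
  by have := ler_normD (clip X t - clip (xn n) t) (clip (xn n) t - clip (xn n) s); lra.
(* The solution returned is the Picard image of [X], which is differentiable as an antiderivative
   and agrees with [X] on the half-line. *)
pose y := pic theta X.
have yX (t : R) : 0 <= t -> y t = X t.
  move=> t0; apply/eqP; rewrite -subr_eq0 -normr_le0; apply/ler_addgt0Pl => e e0.
  rewrite addr0; have [n ne] := small t _ e0; apply: le_trans (ltW ne).
  have -> : y t - X t = (y t - xn n.+1 t) + (xn n.+1 t - X t).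
    by rewrite subrKA.
  apply: le_trans (ler_normD _ _) _.
  (* The contraction and the tail bound each contribute [C / 2 ^+ n * E t]. *)
  have := @pic_lip theta X (xn n) (2 * C / 2 ^+ n) Xc (xnc n) (XP n) t t0.
  have := XP n.+1 t t0; rewrite distrC -/y -/(xn n.+1 t) -/(E t).
  rewrite exprSr invfM mulrA.
  rewrite -[pic theta (xn n) t]/(xn n.+1 t).
  by lra.
exists y; split; first exact: pic0.
split; first by apply: cvg_at_right_filter; exact: (@pic_cont theta X Xc 0 (lexx _)).
move=> t t0; apply/is_derive_coord => k.
by rewrite yX ?(ltW t0)//; exact: (pic_derive theta k Xc (ltW t0)).
Unshelve. all: by end_near. Qed.

End picard.

(** * Perturbed flows *)

(** Scalar Gronwall for the squared Euclidean norm, which is differentiable where the norm need not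
    be. [kappa] depends on neither [C] nor the path, so the bound is linear in [C]. *)
Lemma gronwall_rV (R : realType) (n : nat) (L T : R) : 0 <= L ->
  exists kappa : R, 0 <= kappa /\
    forall (C : R) (e de : R -> 'rV[R]_n), 0 <= C -> e 0 = 0 ->
      (forall k, e t ord0 k @[t --> (0 : R)^'+] --> e 0 ord0 k) ->
      (forall t : R, 0 < t -> is_derive (t : R^o) (1 : R^o) e (de t)) ->
      (forall t, 0 < t -> `|de t| <= C + L * `|e t|) ->
      forall t, 0 <= t <= T -> enorm (e t) <= kappa * C.
Proof.
(* [a], and [b] below, come from [2 * x * y <= x ^+ 2 + y ^+ 2] on each coordinate and from
   splitting the square of [C + L * enorm (e s)], summed over the [n] coordinates. *)
move=> L0; pose N : R := n%:R; pose a := 1 + N * (2 * L ^+ 2).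
have N0 : 0 <= N by rewrite /N.
have a0 : 0 < a by rewrite ltr_pwDl// mulr_ge0// mulr_ge0// sqr_ge0.
pose k2 := N * 2 / a * expR (a * T).
have k20 : 0 <= k2 by rewrite mulr_ge0 ?expR_ge0// divr_ge0 ?mulr_ge0// ltW.
exists (Num.sqrt k2); split=> [|C e de C0 e0 ec ed edle t /andP[t0 tT]].
  exact: sqrtr_ge0.
pose b := N * (2 * C ^+ 2).
have b0 : 0 <= b by rewrite mulr_ge0// mulr_ge0// sqr_ge0.
pose u s := \sum_(i < n) (e s ord0 i) ^+ 2.
have uE s : u s = enorm (e s) ^+ 2 by rewrite sqr_enorm.
have u0 : u 0 = 0 by rewrite /u big1// => i _; rewrite e0 mxE expr0n.
rewrite -ler_sqr ?nnegrE ?enorm_ge0 ?mulr_ge0 ?sqrtr_ge0//.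
rewrite -uE exprMn sqr_sqrtr//.
have -> : k2 * C ^+ 2 = b / a * expR (a * T) by rewrite /k2 /b; ring.
pose du s := \sum_(i < n) (2 * e s ord0 i * de s ord0 i).
have ud (s : R) : 0 < s -> is_derive s 1 u (du s).
  move=> s0; rewrite (_ : u = \sum_(i < n) (fun r => e r ord0 i ^+ 2)); last first.
    by rewrite fct_sumE.
  apply: is_derive_sum => i.
  have eid := (is_derive_coord e s (de s)).1 (ed s s0) i.
  by have := is_deriveX 2 eid; rewrite /GRing.scale/= expr1.
have uc : u t @[t --> (0 : R)^'+] --> u 0.
  apply: cvg_big => [|i _]; last exact: cvgM (ec i) (ec i).
  exact: add_continuous.
have dule (s : R) : 0 < s -> du s <= a * u s + b.
  move=> s0; have -> : a * u s + b = u s + N * (2 * C ^+ 2 + 2 * L ^+ 2 * u s).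
    by rewrite /a /b; ring.
  rewrite [N * _](_ : _ = \sum_(i < n) (2 * C ^+ 2 + 2 * L ^+ 2 * u s)); last first.
    by rewrite sumr_const card_ord -[RHS]mulr_natl.
  rewrite [X in _ <= X + _]/u -big_split/=; apply: ler_sum => i _.
  have des : `|de s ord0 i| <= C + L * enorm (e s).
    apply: le_trans (coord_le_normr _ _) _; apply: le_trans (edle s s0) _.
    by rewrite lerD2l ler_wpM2l// normr_le_enorm.
  have : de s ord0 i ^+ 2 <= (C + L * enorm (e s)) ^+ 2.
    rewrite -real_normK ?num_real// ler_sqr ?nnegrE//.
    by rewrite addr_ge0// mulr_ge0// enorm_ge0.
  rewrite uE; have := sqr_ge0 (e s ord0 i - de s ord0 i).
  have := sqr_ge0 (C - L * enorm (e s)).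
  by rewrite !expr2; lra.
have := gronwall a0 uc ud dule t0; rewrite u0 add0r.
have : 0 <= b / a by rewrite divr_ge0// ltW.
move=> ba0; have : b / a * expR (a * t) <= b / a * expR (a * T).
  by rewrite ler_wpM2l// ler_expR ler_pM2l.
lra.
Qed.

(** Common form of the QSA solutions in slow time. Neither [alpha] nor the probing signal occurs in
    it, so constants derived from it are uniform in both. *)
Definition perturbed_sol (R : realType) (n : nat) (F : 'rV[R]_n -> 'rV[R]_n)
    (C : R) (y : R -> 'rV[R]_n) : Prop :=
  (forall k, y t ord0 k @[t --> (0 : R)^'+] --> y 0 ord0 k) /\
  exists g : R -> 'rV[R]_n, forall t : R, 0 < t ->
    is_derive (t : R^o) (1 : R^o) y (g t) /\ `|g t - F (y t)| <= C.

Lemma is_derive_affine (R : realType) (n : nat) (x : R -> 'rV[R]_n) (a s t : R)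
  (v : 'rV[R]_n) : is_derive (a * t + s : R^o) (1 : R^o) x v ->
  is_derive (t : R^o) (1 : R^o) (fun r => x (a * r + s)) (a *: v).
Proof.
move=> /is_derive_coord xv; apply/is_derive_coord => k; rewrite mxE mulrC.
apply: (@is_derive1_comp _ (fun r => x r ord0 k) (fun r => a * r + s)) => //.
have := is_deriveD (is_deriveZ a (is_derive_id t (1 : R))) (is_derive_cst s t 1).
by rewrite /GRing.scale/= mulr1 addr0.
Qed.

Lemma perturbed_sol_shift (R : realType) (n : nat) (F : 'rV[R]_n -> 'rV[R]_n)
  (C : R) (y : R -> 'rV[R]_n) (s : R) : 0 <= s -> perturbed_sol F C y ->
  perturbed_sol F C (fun t => y (t + s)).
Proof.
move=> s0 [yc [g gP]]; split=> [k|].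
  (* At [s = 0] only the assumed right limit is available; for [s > 0] continuity follows from
     differentiability. *)
  move: s0; rewrite le_eqVlt => /predU1P[<-|s0].
    by under eq_fun do rewrite addr0; rewrite add0r; exact: yc.
  have := (is_derive_coord y s (g s)).1 (gP s s0).1 k.
  move=> [/derivable1_diffP/differentiable_continuous ycs _].
  apply: cvg_at_right_filter; rewrite add0r.
  have cs : (t + s) @[t --> (0 : R)] --> 0 + s.
    by apply: cvgD; [exact: cvg_id|exact: cvg_cst].
  by rewrite add0r in cs; exact: (cvg_comp _ _ cs ycs).
exists (fun t => g (t + s)) => t t0.
have [yd yg] := gP (t + s) (ltr_wpDr s0 t0); split => //.
have := @is_derive_affine _ _ y 1 s t (g (t + s)).
by rewrite scale1r mul1r; under eq_fun do rewrite mul1r; apply.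
Qed.

(** Passage to slow time: the chain-rule factor [alpha^-1] cancels the step size. *)
Lemma perturbed_sol_rescale (R : realType) (n : nat) (F : 'rV[R]_n -> 'rV[R]_n)
  (C alpha : R) (x g : R -> 'rV[R]_n) : 0 < alpha ->
  x t @[t --> (0 : R)^'+] --> x 0 ->
  (forall t : R, 0 < t -> is_derive (t : R^o) (1 : R^o) x (alpha *: g t)) ->
  (forall t, 0 < t -> `|g t - F (x t)| <= C) ->
  perturbed_sol F C (fun t => x (alpha^-1 * t)).
Proof.
move=> a0 xc xd gC; have ai0 : 0 < alpha^-1 by rewrite invr_gt0.
split=> [k|].
  rewrite mulr0; apply/cvgrPdist_le => e e0.
  have /cvgrPdist_le/(_ _ e0)[r /= r0 rP] := xc.
  exists (alpha * r) => /=; first exact: mulr_gt0.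
  move=> t /=; rewrite sub0r normrN => tr t0.
  have := coord_le_normr (x 0 - x (alpha^-1 * t)) k; rewrite !mxE => /le_trans.
  apply; apply: rP => /=; last by rewrite mulr_gt0.
  by rewrite sub0r normrN normrM gtr0_norm// mulrC ltr_pdivrMr// mulrC.
exists (fun t => g (alpha^-1 * t)) => t t0.
have at0 : 0 < alpha^-1 * t by rewrite mulr_gt0.
split; last exact: gC.
have := @is_derive_affine _ _ x alpha^-1 0 t (alpha *: g (alpha^-1 * t)).
rewrite addr0 scalerA mulVf ?gt_eqF// scale1r.
by under eq_fun do rewrite addr0; apply; exact: xd.
Qed.

(** The left end is excluded so that the start of the period lies strictly before [t], where a
    condition imposed on all times before [t] can be applied. *)
Lemma exists_period (R : realType) (T t : R) : 0 < T -> 0 < t ->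
  exists n : nat, n%:R * T < t <= n.+1%:R * T.
Proof.
move=> T0 t0; have ex : exists n : nat, t <= n.+1%:R * T.
  exists (Num.bound (t / T)); rewrite -ler_pdivrMr//.
  apply: (@le_trans _ _ (Num.bound (t / T))%:R); last by rewrite ler_nat.
  by apply/ltW/archi_boundP; rewrite divr_ge0// ltW.
case: (ex_minnP ex) => -[|n] tn nmin; [exists 0%N|exists n.+1]; rewrite tn andbT.
  by rewrite mul0r.
by rewrite ltNge; apply/negP => /nmin; rewrite ltnn.
Qed.

(** Below [M] the sequence stays there, and above it each step costs [q]; by induction [v n] is at
    most the maximum of [M] and [v 0 - n * q]. *)
Lemma le_max_decrement (R : realType) (v : nat -> R) (M q : R) : 0 <= M -> 0 < q ->
  (forall n, v n.+1 <= Num.max M (v n - q)) ->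
  exists N, forall n, (N <= n)%N -> v n <= M.
Proof.
move=> M0 q0 vS.
have vn n : v n <= Num.max M (v 0%N - n%:R * q).
  elim: n => [|n ih]; first by rewrite mul0r subr0 le_max lexx orbT.
  apply: le_trans (vS n) _; rewrite ge_max le_max lexx/=.
  move: ih; rewrite !le_max => /orP[ih|ih]; apply/orP; first by left; lra.
  by right; rewrite -natr1; lra.
have [N vN] : exists N : nat, v 0%N <= N%:R * q.
  exists (Num.bound (`|v 0%N| / q)); rewrite -ler_pdivrMr//.
  apply: (@le_trans _ _ (`|v 0%N| / q)).
    by rewrite ler_pM2r ?invr_gt0// ler_norm.
  by apply/ltW/archi_boundP; rewrite divr_ge0// ltW.
exists N => n Nn; apply: le_trans (vn n) _; rewrite ge_max lexx/=.
have : N%:R * q <= n%:R * q by rewrite ler_pM2r// ler_nat.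
lra.
Qed.

(** Two uses of [gronwall_rV]. The gap to the mean flow is driven by the forcing alone, so [D] does
    not depend on the starting point. The displacement from [y 0] is driven by a term affine in the
    norm of [y 0], which yields [A]. *)
Lemma perturbed_sol_dist (R : realType) (n : nat) (F : 'rV[R]_n -> 'rV[R]_n)
  (L C T : R) : 0 <= L -> 0 <= C -> (forall u v, `|F u - F v| <= L * `|u - v|) ->
  exists D A : R, 0 <= D /\ 0 <= A /\
    forall y, perturbed_sol F C y -> forall t, 0 <= t <= T ->
    enorm (y t) <= A * (1 + enorm (y 0)) /\
    forall x, mean_flow_sol F x -> x 0 = y 0 -> enorm (y t - x t) <= D.
Proof.
move=> L0 C0 FL; have [kappa [k0 kP]] := @gronwall_rV R n L T L0.
pose A := n%:R * (kappa * (C + `|F 0| + L) + 1).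
exists (kappa * C), A; split; first exact: mulr_ge0.
split.
  by apply: mulr_ge0 => //; apply: addr_ge0 => //; apply: mulr_ge0 => //;
     rewrite !addr_ge0.
move=> y [yc [g gP]] t t0T; split.
  have FE u : `|F u| <= `|F 0| + L * `|u|.
    have -> : F u = F 0 + (F u - F 0) by rewrite addrC subrK.
    apply: le_trans (ler_normD _ _) _; rewrite lerD2l.
    by have := FL u 0; rewrite subr0.
  have yE : `|y t - y 0| <= kappa * (C + `|F 0| + L * `|y 0|).
    apply: le_trans (normr_le_enorm _) _.
    apply: (kP _ (fun s => y s - y 0) g) t0T.
    - by rewrite !addr_ge0// mulr_ge0.
    - exact: subrr.
    - move=> k; rewrite subrr mxE; under eq_fun do rewrite mxE [X in _ + X]mxE.
      have yk : (y s ord0 k - y 0 ord0 k) @[s --> (0 : R)^'+] -->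
          y 0 ord0 k - y 0 ord0 k by apply: cvgB; [exact: yc|exact: cvg_cst].
      by rewrite subrr in yk.
    - move=> s s0; apply/is_derive_coord => k.
      have := (is_derive_coord y s (g s)).1 (gP s s0).1 k => yk.
      under eq_fun do rewrite mxE [X in _ + X]mxE.
      by rewrite -[g s ord0 k]subr0; apply: is_deriveB.
    move=> s s0; have -> : g s = (g s - F (y s)) + F (y s) by rewrite subrK.
    apply: le_trans (ler_normD _ _) _; have := (gP s s0).2; have := FE (y s).
    have : L * `|y s| <= L * `|y 0| + L * `|y s - y 0|.
      rewrite -mulrDr ler_wpM2l//.
      have -> : `|y s| = `|y 0 + (y s - y 0)| by rewrite addrC subrK.
      exact: ler_normD.
    lra.
  apply: le_trans (enorm_le_normr _) _; rewrite /A -mulrA ler_wpM2l//.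
  have y0e := normr_le_enorm (y 0).
  have : `|y t| <= `|y 0| + `|y t - y 0|.
    have -> : `|y t| = `|y 0 + (y t - y 0)| by rewrite addrC subrK.
    exact: ler_normD.
  move=> /le_trans; apply; move: (enorm (y 0)) y0e yE => E y0e yE.
  have : kappa * (C + `|F 0| + L * `|y 0|) <= kappa * ((C + `|F 0| + L) * (1 + E)).
    rewrite ler_wpM2l//; have LE : L * `|y 0| <= L * E by rewrite ler_wpM2l.
    have E0 : 0 <= E by apply: le_trans y0e.
    have : 0 <= (C + `|F 0|) * E by rewrite mulr_ge0// addr_ge0.
    lra.
  lra.
move=> x [xc xd] x0.
apply: (kP _ (fun s => y s - x s) (fun s => g s - F (x s))) t0T => //.
- by rewrite x0 subrr.
- move=> k; rewrite x0 mxE [X in _ + X]mxE.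
  under eq_fun do rewrite mxE [X in _ + X]mxE.
  apply: cvgB; first exact: yc.
  rewrite -x0.
  exact: (cvg_comp x (fun v : 'rV[R]_n => v ord0 k) xc
    (@coord_continuous R 1 n ord0 k (x 0))).
- move=> s s0; apply/is_derive_coord => k; rewrite mxE [X in _ + X]mxE.
  under eq_fun do rewrite mxE [X in _ + X]mxE.
  apply: is_deriveB.
    exact: (is_derive_coord y s (g s)).1 (gP s s0).1 k.
  exact: (is_derive_coord x s _).1 (xd s s0) k.
move=> s s0; have -> : g s - F (x s) = (g s - F (y s)) + (F (y s) - F (x s)).
  by rewrite subrKA.
apply: le_trans (ler_normD _ _) _; apply: lerD; first exact: (gP s s0).2.
exact: FL.
Qed.

(** Sampling at multiples of [T] reduces both claims to sequences. Far out, [V] is at most [c] times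
    the norm, so its decrease proportional to the norm becomes a contraction by [expR (- q)]; [A]
    controls the times inside a period. *)
Lemma perturbed_sol_ultimately_bounded (R : realType) (n : nat)
  (F : 'rV[R]_n -> 'rV[R]_n) (L C : R) : 0 < L -> 0 <= C ->
  (forall u v, `|F u - F v| <= L * `|u - v|) -> V4' F ->
  exists b delta B : R, 0 < b /\ 0 < delta /\
  forall y, perturbed_sol F C y ->
    (forall t, 0 <= t -> (forall s, 0 <= s < t -> delta^-1 < enorm (y s)) ->
       enorm (y t) <= b * enorm (y 0) * expR (- (delta * t))) /\
    exists t0, forall t, t0 <= t -> enorm (y t) <= B.
Proof.
move=> L0 C0 FL [V [LV [d0 [d1 [T [d00 [d10 [T0 [V0 [VL [Vge Vdec]]]]]]]]]]].
have [D [A [D0 [A0 DA]]]] := perturbed_sol_dist T (ltW L0) C0 FL.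
(* The sign of [LV] is not given. *)
pose K := Num.max LV 0.
have K0 : 0 <= K by rewrite le_max lexx orbT.
have VK u v : V u <= V v + K * enorm (u - v).
  have := VL v u; rewrite ler_norml => /andP[_ +].
  have : LV * enorm (u - v) <= K * enorm (u - v).
    by rewrite ler_wpM2r ?enorm_ge0// le_max lexx.
  lra.
(* Beyond [r]: [d1^-1] triggers the decrease of [V], [d0^-1] puts the norm below [V], 1 gives
   [V u <= c * enorm u], and the last entry lets half of the decrease absorb the error [K * D]. *)
pose r := Num.max (Num.max d1^-1 d0^-1) (Num.max 1 (2 * K * D / d1)).
have r_d1 : d1^-1 <= r by rewrite !le_max lexx.
have r_d0 : d0^-1 <= r by rewrite !le_max lexx !orbT.
have r1 : 1 <= r by rewrite !le_max lexx !orbT.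
have rK : K * D <= d1 / 2 * r.
  have : 2 * K * D / d1 <= r by rewrite !le_max lexx !orbT.
  by rewrite ler_pdivrMr//; lra.
have r0 : 0 < r by exact: lt_le_trans r1.
pose c := V 0 + K + 1.
have c0 : 0 < c by have := V0 0; rewrite /c; lra.
have Vc u : 1 <= enorm u -> V u <= c * enorm u.
  move=> u1; have := VK u 0; rewrite subr0 => /le_trans; apply.
  have : V 0 * 1 <= V 0 * enorm u by rewrite ler_wpM2l.
  rewrite /c; lra.
(* Relative decrease per period: the remaining half [d1 / 2 * enorm u] is at least [q * V u]. *)
pose q := d1 / (2 * c).
have q0 : 0 < q by rewrite divr_gt0// mulr_gt0.
have dec y : perturbed_sol F C y -> r < enorm (y 0) ->
    V (y T) <= V (y 0) - d1 / 2 * enorm (y 0).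
  move=> yP ry.
  have [x [x0 xP]] := picard L0 FL (y 0).
  have TT : 0 <= T <= T by rewrite lexx ltW.
  have [_ /(_ x xP x0) yx] := DA y yP T TT.
  have := Vdec x xP 0 (lexx 0); rewrite x0 add0r => /(_ (le_lt_trans r_d1 ry)).
  have := VK (y T) (x T).
  have : K * enorm (y T - x T) <= K * D by rewrite ler_wpM2l.
  have : d1 / 2 * r <= d1 / 2 * enorm (y 0) by rewrite ler_pM2l ?divr_gt0// ltW.
  lra.
have decq y : perturbed_sol F C y -> r < enorm (y 0) -> V (y T) <= expR (- q) * V (y 0).
  move=> yP ry; apply: le_trans (dec y yP ry) _.
  apply: (@le_trans _ _ ((1 - q) * V (y 0))).
    have : q * V (y 0) <= q * (c * enorm (y 0)).
      by rewrite ler_wpM2l ?(ltW q0)// Vc// (le_trans r1)// ltW.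
    have -> : q * (c * enorm (y 0)) = d1 / 2 * enorm (y 0).
      by rewrite /q; field; rewrite gt_eqF.
    lra.
  by rewrite ler_wpM2r// expR_ge1Dx.
(* [2 * A] covers growth inside a period, [c] compares [V] with the initial norm, [expR q] pays for
   the unfinished period, and the final 1 gives [1 <= b] for time 0. *)
pose b := 2 * A * c * expR q + 1.
(* [r^-1] ensures that a norm above [delta^-1] is above [r]; [q / T] is the decay rate per unit of
   time. *)
pose delta := Num.min r^-1 (q / T).
have delta0 : 0 < delta by rewrite lt_min invr_gt0 r0 divr_gt0.
have delta_r : r <= delta^-1.
  by rewrite -[leLHS]invrK lef_pV2 ?posrE ?invr_gt0// ge_min lexx.
have Ac0 : 0 <= 2 * A * c * expR q.
  by rewrite mulr_ge0 ?expR_ge0// mulr_ge0 ?(ltW c0)// mulr_ge0.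
have nT0 k : 0 <= k%:R * T by rewrite mulr_ge0// ltW.
(* Eventually every period starts with norm at most [r] or with [V] at most the [M] below; the sum
   covers both cases, and [A] adds one period of growth. *)
pose B := A * (1 + (r + (V 0 + K * (A * (1 + r))))).
exists b, delta, B; split; first by rewrite /b; lra.
split=> // y yP.
have shift k := perturbed_sol_shift (nT0 k) yP.
have nST k : k.+1%:R * T = T + k%:R * T by rewrite -natr1 mulrDl mul1r addrC.
have within_period k t : k%:R * T < t <= k.+1%:R * T ->
    enorm (y t) <= A * (1 + enorm (y (k%:R * T))).
  move=> /andP[kt tk]; have tT : 0 <= t - k%:R * T <= T by move: tk; rewrite nST; lra.
  by have [+ _] := DA _ (shift k) _ tT; rewrite subrK add0r.
split=> [t t0 yt|].
  move: t0; rewrite le_eqVlt => /predU1P[<-|t0].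
    rewrite mulr0 oppr0 expR0 mulr1 ler_peMl ?enorm_ge0//.
    by rewrite /b; lra.
  have [k /andP[kt tk]] := exists_period T0 t0.
  have big j : (j <= k)%N -> r < enorm (y (j%:R * T)).
    move=> jk; apply: le_lt_trans delta_r _; apply: yt; rewrite nT0/=.
    by apply: le_lt_trans kt; rewrite ler_pM2r// ler_nat.
  have Vk j : (j <= k)%N -> V (y (j%:R * T)) <= expR (- (q * j%:R)) * V (y 0).
    elim: j => [|j ih] jk; first by rewrite mul0r mulr0 oppr0 expR0 mul1r.
    have := decq _ (shift j); rewrite add0r => /(_ (big _ (ltnW jk))).
    rewrite -nST => /le_trans; apply.
    apply: le_trans (ler_wpM2l (expR_ge0 _) (ih (ltnW jk))) _.
    by rewrite mulrA -expRD -natr1 mulrDr mulr1 opprD addrC.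
  have rk := big k (leqnn k).
  have /within_period yk : k%:R * T < t <= k.+1%:R * T by rewrite kt tk.
  have ry0 : r < enorm (y 0) by have := big 0%N (leq0n _); rewrite mul0r.
  apply: le_trans yk _.
  apply: (@le_trans _ _ (2 * A * V (y (k%:R * T)))).
    have : enorm (y (k%:R * T)) <= V (y (k%:R * T)).
      by apply: Vge; apply: le_trans r_d0 _; exact: ltW.
    move=> eV; rewrite [2 * A]mulrC -mulrA ler_wpM2l//; lra.
  apply: (@le_trans _ _ (2 * A * (expR (q - q * (t / T)) * (c * enorm (y 0))))).
    rewrite ler_wpM2l ?mulr_ge0//; apply: le_trans (Vk k (leqnn k)) _.
    apply: ler_pM; rewrite ?expR_ge0//; last first.
      by apply: Vc; apply: le_trans r1 _; exact: ltW.
    (* From [t <= k.+1%:R * T], at least [t / T - 1] full periods have elapsed. *)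
    rewrite ler_expR -[X in X - _]mulr1 -mulrBr -mulrN ler_pM2l//.
    rewrite -ler_pdivrMr// in tk; move: tk; rewrite -natr1; lra.
  have -> : 2 * A * (expR (q - q * (t / T)) * (c * enorm (y 0))) =
      2 * A * c * expR q * enorm (y 0) * expR (- (q / T * t)).
    by rewrite expRD [q * (t / T)]mulrCA [t * _]mulrC; ring.
  apply: ler_pM (mulr_ge0 Ac0 (enorm_ge0 _)) (expR_ge0 _) _ _.
    by rewrite ler_wpM2r ?enorm_ge0// /b; lra.
  by rewrite ler_expR lerN2 ler_pM2r// ge_min lexx orbT.
(* Bound on [V] after a period that starts within radius [r]. *)
pose M := V 0 + K * (A * (1 + r)).
have M0 : 0 <= M by rewrite addr_ge0// !mulr_ge0// addr_ge0// ltW.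
have := @le_max_decrement _ (fun k => V (y (k%:R * T))) M (d1 / 2 * r) M0.
case=> [||N VN]; first by rewrite mulr_gt0// divr_gt0.
  move=> k; rewrite nST le_max; have [yr|yr] := leP (enorm (y (k%:R * T))) r.
    apply/orP; left; have := VK (y (T + k%:R * T)) 0; rewrite subr0 => /le_trans; apply.
    rewrite lerD2l ler_wpM2l// -nST.
    apply: le_trans (within_period k _ _) _; last first.
      by rewrite ler_wpM2l// lerD2l.
    by rewrite lexx andbT nST ltrDr.
  apply/orP; right.
  have := dec _ (shift k); rewrite add0r => /(_ yr) /le_trans; apply.
  by rewrite lerD2l lerN2 ler_pM2l ?divr_gt0// ltW.
(* The extra 1 makes [N%:R * T < t] strict, so that the period containing [t] has index at least
   [N]. *)
exists (N%:R * T + 1) => t Nt.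
have t0 : 0 < t by apply: lt_le_trans Nt; rewrite ltr_wpDl.
have [k /andP[kt tk]] := exists_period T0 t0.
have Nk : (N <= k)%N.
  rewrite -ltnS -(ltr_nat R) -(ltr_pM2r T0); apply: lt_le_trans tk.
  by apply: lt_le_trans Nt; rewrite ltrDl.
have /within_period/le_trans : k%:R * T < t <= k.+1%:R * T by rewrite kt tk.
apply; rewrite /B ler_wpM2l// lerD2l -/M.
have [yr|/ltW yr] := leP (enorm (y (k%:R * T))) r; first by rewrite ler_wpDr.
by apply: le_trans (Vge _ (le_trans r_d0 yr)) _; rewrite ler_wpDl ?VN// ltW.
Qed.

(** * The QSA forcing *)

Lemma Omega_coord_le1 (R : realType) (K : nat) (omega phi : 'I_K -> R)
  (z : torus R K) (i : 'I_K) : Omega omega phi z ->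
  `|(tnth z i).1| <= 1 /\ `|(tnth z i).2| <= 1.
Proof.
move=> Oz.
have bnd (u : R) : (forall e, 0 < e -> exists2 v, `|u - v| < e & -1 <= v <= 1) ->
    `|u| <= 1.
  move=> uP; apply/ler_addgt0Pl => e e0; have [v uv v1] := uP e e0.
  have v1' : `|v| <= 1 by rewrite ler_norml.
  have := ler_normD (u - v) v; rewrite subrK => /le_trans; apply.
  by rewrite lerD// ltW.
by split; apply: bnd => e /Oz[t /(_ i)]; rewrite !tnth_mktuple/= => -[z1 z2];
  eexists; [exact: z1| |exact: z2|]; rewrite ?cos_geN1 ?cos_le1 ?sin_geN1 ?sin_le1.
Qed.

(** The constant 2 is the triangle inequality on the rotation formula; any bound independent of [t]
    serves. *)
Lemma flow_coord_le2 (R : realType) (K : nat) (omega phi : 'I_K -> R) (t : R)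
  (z : torus R K) (i : 'I_K) : Omega omega phi z ->
  `|(tnth (flow omega t z) i).1| <= 2.
Proof.
move=> /(Omega_coord_le1 i)[z1 z2]; rewrite tnth_mktuple/=.
set th := 2 * pi * omega i * t.
have c1 : `|cos th| <= 1 by rewrite ler_norml cos_geN1 cos_le1.
have s1 : `|sin th| <= 1 by rewrite ler_norml sin_geN1 sin_le1.
apply: le_trans (ler_normB _ _) _; rewrite !normrM.
have -> : 2 = 1 * 1 + 1 * 1 :> R by ring.
by apply: lerD; apply: ler_pM.
Qed.

Lemma enorm0 (R : realType) (n : nat) : enorm (0 : 'rV[R]_n) = 0.
Proof.
apply: le_anti; rewrite enorm_ge0 andbT.
by apply: le_trans (enorm_le_normr _) _; rewrite normr0 mulr0.
Qed.

(** [f theta] is Lipschitz in the signal with a constant free of [theta], and the signal ranges over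
    a bounded set. Its oscillation, and with it the distance to its mean, is therefore bounded
    uniformly in [theta]. *)
Lemma fbar_dist (R : realType) (d m K : nat) (omega phi : 'I_K -> R)
  (P : probability (torus R K) R) (G0 : 'rV[R]_K -> 'rV[R]_m)
  (f : 'rV[R]_d -> 'rV[R]_m -> 'rV[R]_d) :
  real_analytic G0 -> uniform_on_Omega omega phi P -> A1 (fbar P G0 f) f ->
  exists C : R, 0 <= C /\ forall theta w,
    (forall i, `|(tnth w i).1| <= 2) ->
    `|f theta (Gmap G0 w) - fbar P G0 f theta| <= C.
Proof.
move=> G0a [PO _] [Lf [_ fL]].
have [M GM] := real_analytic_bounded 2 G0a.
have Gw (w : torus R K) : (forall i, `|(tnth w i).1| <= 2) -> `|Gmap G0 w| <= M.
  by move=> w2; apply: GM => i; rewrite mxE.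
have M0 : 0 <= M.
  by apply: le_trans (normr_ge0 _) (GM 0 _) => i; rewrite mxE normr0.
pose L := Num.max Lf 0.
have L0 : 0 <= L by rewrite le_max lexx orbT.
have C0 : 0 <= L * (m%:R * (2 * M)) by rewrite !mulr_ge0.
(* [2 * M] bounds the gap between two signals in sup norm, [m%:R] converts it to the Euclidean norm,
   and the outer 2 comes from [Rintegral_dist_le]. *)
exists (2 * (L * (m%:R * (2 * M)))); split; first exact: mulr_ge0.
move=> theta w w2; apply: normr_rV_le => [|k]; first exact: mulr_ge0.
rewrite mxE [X in _ + X]mxE mxE distrC.
apply: (Rintegral_dist_le (measurable_Omega omega phi) PO) => z Oz.
have z2 i : `|(tnth z i).1| <= 2.
  by have [+ _] := Omega_coord_le1 i Oz => /le_trans; apply; rewrite ler1n.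
have -> : f theta (Gmap G0 z) ord0 k - f theta (Gmap G0 w) ord0 k =
    (f theta (Gmap G0 z) - f theta (Gmap G0 w)) ord0 k.
  by rewrite [RHS]mxE [X in _ = _ + X]mxE.
apply: le_trans (coord_le_normr _ _) _; apply: le_trans (normr_le_enorm _) _.
have := fL theta theta (Gmap G0 w) (Gmap G0 z).
rewrite !subrr enorm0 !add0r => /le_trans; apply.
apply: (@le_trans _ _ (L * enorm (Gmap G0 z - Gmap G0 w))).
  by rewrite ler_wpM2r ?enorm_ge0// le_max lexx.
rewrite ler_wpM2l//; apply: le_trans (enorm_le_normr _) _; rewrite ler_wpM2l//.
by apply: le_trans (ler_normB _ _) _; have := Gw _ z2; have := Gw _ w2; lra.
Qed.

(** * Stability of the QSA ODE *)

Unset Implicit Arguments.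

(** The condition [t <= T_1] is expressed through the norms at times before [t], which also covers a
    path that never enters the ball. *)
Theorem theorem2p7 (R : realType) (d m K : nat)
  (omega phi : 'I_K -> R) (G0 : 'rV[R]_K -> 'rV[R]_m)
  (f : 'rV[R]_d -> 'rV[R]_m -> 'rV[R]_d) (P : probability (torus R K) R) :
  (0 < d)%N -> (0 < m)%N -> (0 < K)%N ->
  (forall i, 0 < omega i) ->
  real_analytic G0 -> abs_summable_taylor G0 ->
  continuous (fun p : 'rV[R]_d * 'rV[R]_m => f p.1 p.2) ->
  uniform_on_Omega omega phi P ->
  A1 (fbar P G0 f) f ->
  V4' (fbar P G0 f) ->
  exists alpha0 : R, 0 < alpha0 /\
  exists b delta : R, 0 < b /\ 0 < delta /\
    (forall alpha : R, 0 < alpha <= alpha0 ->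
     forall (z : torus R K) (Theta : R -> 'rV[R]_d),
       Omega omega phi z -> qsa_sol omega G0 f alpha z Theta ->
       forall t : R, 0 <= t ->
         (forall s : R, 0 <= s < t -> delta^-1 < enorm (Theta s)) ->
         enorm (Theta t) <= b * enorm (Theta 0) * expR (- (alpha * delta * t))) /\
    (exists B : R,
     forall alpha : R, 0 < alpha <= alpha0 ->
     forall (z : torus R K) (Theta : R -> 'rV[R]_d),
       Omega omega phi z -> qsa_sol omega G0 f alpha z Theta ->
       exists t0 : R, forall t : R, t0 <= t -> enorm (Theta t) <= B).
Proof.
move=> _ _ _ _ G0a _ _ PU fA1 fV.
have [C [C0 fC]] := fbar_dist G0a PU fA1.
have [Lf [fbL _]] := fA1.
(* [d%:R] converts the Lipschitz bound from Euclidean to sup norm, and [+ 1] makes it positive. *)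
pose L := Num.max Lf 0 * d%:R + 1.
have L0 : 0 < L by rewrite ltr_wpDl// mulr_ge0// le_max lexx orbT.
have FL u v : `|fbar P G0 f u - fbar P G0 f v| <= L * `|u - v|.
  apply: le_trans (normr_le_enorm _) _; apply: le_trans (fbL _ _) _.
  apply: (@le_trans _ _ (Num.max Lf 0 * enorm (u - v))).
    by rewrite ler_wpM2r ?enorm_ge0// le_max lexx.
  apply: (@le_trans _ _ (Num.max Lf 0 * (d%:R * `|u - v|))).
    by rewrite ler_wpM2l ?enorm_le_normr// le_max lexx orbT.
  by rewrite mulrA ler_wpM2r// lerDl.
have [b [delta [B [b0 [delta0 stab]]]]] :=
  perturbed_sol_ultimately_bounded L0 C0 FL fV.
have rescaled (alpha : R) z Theta : 0 < alpha -> Omega omega phi z ->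
    qsa_sol omega G0 f alpha z Theta ->
    perturbed_sol (fbar P G0 f) C (fun t => Theta (alpha^-1 * t)).
  move=> a0 Oz [Tc Td].
  apply: (@perturbed_sol_rescale _ _ _ C alpha Theta
    (fun t => f (Theta t) (Gmap G0 (flow omega t z)))) => //.
  by move=> t _; apply: fC => i; exact: flow_coord_le2 Oz.
(* The constants of [stab] are free of [alpha], so the threshold 1 is an arbitrary choice. *)
exists 1; split=> //; exists b, delta; split=> //; split=> //; split.
  move=> alpha /andP[a0 _] z Theta Oz ThS t t0 Tt.
  have [+ _] := stab _ (rescaled alpha z Theta a0 Oz ThS).
  (* Slow time [alpha * t] is original time [t], whence the rate [alpha * delta]. *)
  move=> /(_ (alpha * t)); rewrite mulr0 mulKf ?gt_eqF//.
  have -> : delta * (alpha * t) = alpha * delta * t by ring.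
  apply; first by rewrite mulr_ge0// ltW.
  move=> s /andP[s0 st]; apply: Tt.
  by rewrite mulr_ge0 ?invr_ge0 ?(ltW a0)//= ltr_pdivrMl.
exists B => alpha /andP[a0 _] z Theta Oz ThS.
have [_ [t0 t0P]] := stab _ (rescaled alpha z Theta a0 Oz ThS).
(* The entry time scales with [alpha^-1], while [B] does not. *)
exists (alpha^-1 * t0) => t tt0.
have := t0P (alpha * t); rewrite mulKf ?gt_eqF//; apply.
by rewrite -ler_pdivrMl.
Qed.
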